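(* Let $\rho\in(-1,1)$, $\rho\ne0$, and let $(Y_n)_{n\ge1}$ be i.i.d. with $\mathbb{E}[|Y_1|^a]<\infty$ for some $a>0$. Set $Z:=\sum_{n=1}^\infty\rho^nY_n$ (an a.s. convergent series). Let $\varphi$ be the characteristic function of $Y_1$ and assume there are $\delta\in(0,|\rho|)$ and $t_0>0$ such that $|\varphi(t)|\le\delta$ for all $|t|\ge t_0$. Then $\mathbb{P}(|Z|\le\varepsilon)\precsim\varepsilon$ as $\varepsilon\downarrow0$.
   Context: $f\precsim g$ as $\varepsilon\downarrow0$ means $\limsup_{\varepsilon\downarrow0}f(\varepsilon)/g(\varepsilon)<\infty$. *)

(* Defs.v *)
From HB Require Import structures.
From mathcomp Require Import all_boot all_order all_algebra.
From mathcomp Require Import all_classical all_reals all_analysis.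
Set Implicit Arguments. Unset Strict Implicit. Unset Printing Implicit Defensive.
Import Order.TTheory GRing.Theory Num.Theory numFieldTopology.Exports numFieldNormedType.Exports.
Local Open Scope classical_set_scope.
Local Open Scope ring_scope.

Definition mutually_independent d (T : measurableType d) (R : realType)
  (P : probability T R) (Y : nat -> T -> R) : Prop :=
  forall (I : seq nat) (B : nat -> set R), uniq I ->
    (forall i, measurable (B i)) ->
    P (\big[setI/setT]_(i <- I) (Y i @^-1` B i)) =
    (\prod_(i <- I) P (Y i @^-1` B i))%E.

Definition identically_distributed d (T : measurableType d) (R : realType)
  (P : probability T R) (Y : nat -> T -> R) : Prop :=
  forall n (B : set R), measurable B -> P (Y n @^-1` B) = P (Y 0%N @^-1` B).

(* Characteristic function phi_X(t) = E[exp(i t X)] = E[cos(tX)] + i E[sin(tX)],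
   given by its real and imaginary parts, and its modulus. *)
Definition charfun_re d (T : measurableType d) (R : realType)
  (P : probability T R) (X : T -> R) (t : R) : R :=
  fine ('E_P[fun w => cos (t * X w)])%E.
Definition charfun_im d (T : measurableType d) (R : realType)
  (P : probability T R) (X : T -> R) (t : R) : R :=
  fine ('E_P[fun w => sin (t * X w)])%E.
Definition charfun_abs d (T : measurableType d) (R : realType)
  (P : probability T R) (X : T -> R) (t : R) : R :=
  Num.sqrt (charfun_re P X t ^+ 2 + charfun_im P X t ^+ 2).

(* Z = sum_{n>=1} rho^n Y_n, with Y_n indexed from 0 here (Y_{n+1} = Y n). *)
Definition Zseries d (T : measurableType d) (R : realType)
  (rho : R) (Y : nat -> T -> R) (w : T) : R :=
  limn (series (fun n => rho ^+ n.+1 * Y n w) : R^nat).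

(* Main.v *)
Require Import Defs.
From HB Require Import structures.
From mathcomp Require Import all_boot all_order all_algebra.
From mathcomp Require Import all_classical all_reals all_analysis.
From mathcomp Require Import measurable_realfun ring lra.
Import Order.TTheory GRing.Theory Num.Theory numFieldTopology.Exports numFieldNormedType.Exports.
Local Open Scope classical_set_scope.
Local Open Scope ring_scope.

(* A discrete Fejer kernel replaces Fourier inversion. For a random variable S,
   |\sum_(k < M) e^(ikS)|^2 is nonnegative everywhere and at least (M cos 1)^2
   on {|S| <= 1/M}; taking expectations,
     cos(1)^2 M P(|S| <= 1/M) <= 2 \sum_(m < M) |phi_S(m)|.
   For the partial sums S_N = \sum_(n < N) rho^(n+1) Y_n, |phi_(S_N)(m)| is the
   product of the |phi(rho^(n+1) m)|, hence at most delta^j, where j is the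
   number of factors with |rho|^(n+1) m >= t0. Fewer than t0 / |rho|^(j+1) + 1
   integers m have at most j such factors, so the sum over m is dominated by
   geometric series of ratios delta / |rho| < 1 and delta, uniformly in M and N.
   Letting N tend to infinity, with almost sure convergence given by Markov's
   inequality and Borel-Cantelli, transfers the bound to Z. *)

(** * Bounded measurable functions *)

Section bounded_measurable.
Context {d} {T : measurableType d} {R : realType}.
Implicit Types f g : T -> R.

Definition bounded_measurable f :=
  measurable_fun setT f /\ exists K : R, forall x, `|f x| <= K.

Lemma bounded_measurable_cst (c : R) : bounded_measurable (fun=> c).
Proof. by split; [exact: measurable_cst|exists `|c|]. Qed.

Lemma bounded_measurableD {f g} : bounded_measurable f ->
  bounded_measurable g -> bounded_measurable (fun x => f x + g x).
Proof.
move=> [mf [K fK]] [mg [L gL]]; split; first exact: measurable_funD.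
by exists (K + L) => x; rewrite (le_trans (ler_normD _ _))// lerD.
Qed.

Lemma bounded_measurableM {f g} : bounded_measurable f ->
  bounded_measurable g -> bounded_measurable (fun x => f x * g x).
Proof.
move=> [mf [K fK]] [mg [L gL]]; split; first exact: measurable_funM.
by exists (K * L) => x; rewrite normrM ler_pM.
Qed.

Lemma bounded_measurableZ (c : R) {f} :
  bounded_measurable f -> bounded_measurable (fun x => c * f x).
Proof. by apply: bounded_measurableM; exact: bounded_measurable_cst. Qed.

Lemma bounded_measurableN {f} :
  bounded_measurable f -> bounded_measurable (fun x => - f x).
Proof.
by move/(bounded_measurableZ (-1)); under eq_fun do rewrite mulN1r.
Qed.

Lemma bounded_measurable_indic {A : set T} :
  measurable A -> bounded_measurable (\1_A : T -> R).
Proof.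
move=> mA; split; first exact: measurable_indic.
by exists 1 => x; rewrite indicE; case: (_ \in _); rewrite ?normr1 ?normr0.
Qed.

Lemma bounded_measurable_sum I (s : seq I) (f : I -> T -> R) :
  (forall i, bounded_measurable (f i)) ->
  bounded_measurable (fun x => \sum_(i <- s) f i x).
Proof.
move=> bf; elim: s => [|i s ih].
  by under eq_fun do rewrite big_nil; exact: bounded_measurable_cst.
by under eq_fun do rewrite big_cons; exact: bounded_measurableD.
Qed.

Lemma sum_nat_le (n : nat) (y : R) : 0 <= y <= n%:R ->
  y - 1 <= \sum_(j < n) (j.+1%:R <= y)%R%:R <= y.
Proof.
elim: n => [|n ih] /andP[y0 yn].
  rewrite big_ord0; lra.
rewrite big_ord_recr/=; have [yn'|yn'] := leP y n%:R.
  have := ih; rewrite y0 yn' => /(_ isT).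
  suff -> : (n.+1%:R <= y) = false by rewrite addr0.
  by apply/negbTE; rewrite -ltNge (le_lt_trans yn')// ltr_nat.
have -> : \sum_(j < n) (j.+1%:R <= y)%R%:R = n%:R :> R.
  rewrite -[in RHS](card_ord n) -sumr_const; apply: eq_bigr => j _.
  by rewrite (le_trans _ (ltW yn'))// ler_nat.
move: yn; rewrite -natr1.
by have [|] := leP (n%:R + 1) y => /= h1 h2; apply/andP; split; lra.
Qed.

(* The layer sum [n^-1 * \sum_(j < n) 1_{f >= (j+1)/n}] approximates
   [f : T -> [0, 1]] uniformly within [1/n]. *)
Lemma bounded_functional_eq0 (L : (T -> R) -> R) (K : R) :
  (forall f g, bounded_measurable f -> bounded_measurable g ->
     L (fun x => f x + g x) = L f + L g) ->
  (forall (c : R) f, bounded_measurable f -> L (fun x => c * f x) = c * L f) ->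
  (forall f (e : R), bounded_measurable f -> (forall x, `|f x| <= e) ->
     `|L f| <= K * e) ->
  (forall A, measurable A -> L \1_A = 0) ->
  forall f, bounded_measurable f -> L f = 0.
Proof.
move=> LD LZ Lb L0.
have L01 f : bounded_measurable f -> (forall x, 0 <= f x <= 1) -> L f = 0.
  move=> bf f01.
  have mA (c : R) : measurable [set x | c <= f x].
    by rewrite -[X in measurable X]setTI;
      apply: (measurable_fun_le measurableT (measurable_cst c) bf.1).
  pose s n (x : T) : R := \sum_(j < n) \1_[set x | j.+1%:R / n%:R <= f x] x.
  have bs n : bounded_measurable (s n).
    by apply: bounded_measurable_sum => j; exact: bounded_measurable_indic.
  have Ls n : L (s n) = 0.
    rewrite /s; elim: (index_enum _) => [|j t ih].
      rewrite (_ : (fun _ => _) = fun x => 0 * \1_(@set0 T) x :> R).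
        by rewrite LZ ?mul0r//; apply: bounded_measurable_indic.
      by apply/funext => x; rewrite big_nil mul0r.
    under eq_fun do rewrite big_cons.
    rewrite LD ?ih ?addr0 ?L0//; first exact: bounded_measurable_indic.
    by apply: bounded_measurable_sum => i; exact: bounded_measurable_indic.
  have Lfn n : `|L f| * n.+1%:R <= K.
    pose h x := f x - n.+1%:R^-1 * s n.+1 x.
    have bh : bounded_measurable h.
      by apply: bounded_measurableD => //; apply: bounded_measurableN;
        exact: bounded_measurableZ.
    have : `|L h| <= K * n.+1%:R^-1.
      apply: Lb => // x.
      have n0 : 0 < n.+1%:R :> R by rewrite ltr0n.
      have /sum_nat_le : 0 <= n.+1%:R * f x <= n.+1%:R.
        have /andP[f0 f1] := f01 x.
        by rewrite mulr_ge0//= -[leRHS]mulr1 ler_pM2l.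
      rewrite (eq_bigr (fun j : 'I_n.+1 =>
        \1_[set x | j.+1%:R / n.+1%:R <= f x] x)); last first.
        move=> j _; rewrite indicE; congr (nat_of_bool _)%:R.
        by apply/idP/idP; rewrite inE/= ler_pdivrMr// [f x * _]mulrC.
      rewrite -/(s _ _) => /andP[h1 h2].
      rewrite -(ler_pM2l n0) -[X in X * `|_|](gtr0_norm n0) -normrM mulrBr.
      rewrite mulrA divff ?gt_eqF// mul1r.
      by rewrite ger0_norm ?subr_ge0//; lra.
    rewrite -ler_pdivlMr ?ltr0n//; apply: le_trans.
    have -> : f = (fun x => h x + n.+1%:R^-1 * s n.+1 x).
      by apply/funext => x; rewrite /h subrK.
    by rewrite LD ?LZ ?Ls ?mulr0 ?addr0//; exact: bounded_measurableZ.
  apply/eqP; rewrite -normr_eq0; apply/eqP.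
  have [//|Lf0] := eqVneq `|L f| 0.
  have {}Lf0 : 0 < `|L f| by rewrite lt_def Lf0/=.
  have := Lfn (Num.truncn (K / `|L f|)).
  rewrite mulrC -ler_pdivlMr// leNgt.
  by rewrite truncnS_gt.
move=> f bf; have [mf [C fC]] := bf.
pose D := `|C| + 1; have D0 : 0 < D by rewrite ltr_wpDl.
have -> : f = (fun x => (D *+ 2) * ((D *+ 2)^-1 * (f x + D)) + - D * \1_setT x).
  apply/funext => x; rewrite indicT/= mulr1 mulrA divff ?gt_eqF//.
    by rewrite mul1r addrK.
  by rewrite pmulrn_lgt0.
have bD : bounded_measurable (fun x => f x + D).
  by apply: bounded_measurableD => //; exact: bounded_measurable_cst.
have bT : bounded_measurable (\1_setT : T -> R).
  exact: bounded_measurable_indic.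
rewrite LD; [|by do 2 apply: bounded_measurableZ|exact: bounded_measurableZ].
rewrite !LZ//; [|exact: bounded_measurableZ].
rewrite L0// mulr0 addr0 -LZ// L01 ?mulr0//; first exact: bounded_measurableZ.
move=> x; have D20 : 0 < D *+ 2 by rewrite pmulrn_lgt0.
have /ler_normlP[h1 h2] : `|f x| <= D.
  by rewrite (le_trans (fC x))// (le_trans (ler_norm _))// lerDl.
by rewrite mulrC ler_pdivlMr// ler_pdivrMr// mul0r mul1r; apply/andP; split; lra.
Qed.

End bounded_measurable.

Section expectation_bounded.
Context {d} {T : measurableType d} {R : realType} (P : probability T R).
Implicit Types f g : T -> R.

Lemma bounded_measurable_integrable {f} :
  bounded_measurable f -> P.-integrable setT (EFin \o f).
Proof.
move=> [mf [K fK]]; apply: measurable_bounded_integrable => //.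
  by rewrite fin_num_fun_lty.
exists K; split; first exact: num_real.
by move=> M KM x _ /=; rewrite (le_trans (fK x))// ltW.
Qed.
Let bmi {f} := @bounded_measurable_integrable f.

Lemma Rexpectation_norm_le f (e : R) : bounded_measurable f ->
  (forall x, `|f x| <= e) -> `|\int[P]_x f x| <= e.
Proof.
move=> bf fe; apply: (le_trans (le_normr_Rintegral measurableT (bmi bf))).
apply: (@le_trans _ _ (\int[P]_x (cst e x))).
  apply: le_Rintegral => //; last exact: bmi (bounded_measurable_cst _).
  by have /integrable_norm := bmi bf.
by rewrite Rintegral_cst//= probability_setT mulr1.
Qed.

Lemma RexpectationD {f g} : bounded_measurable f -> bounded_measurable g ->
  \int[P]_x (f x + g x) = \int[P]_x f x + \int[P]_x g x.
Proof. by move=> bf bg; apply: RintegralD => //; exact: bmi. Qed.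

Lemma RexpectationZ (c : R) {f} : bounded_measurable f ->
  \int[P]_x (c * f x) = c * \int[P]_x f x.
Proof. by move=> bf; apply: RintegralZl => //; exact: bmi. Qed.

Lemma RexpectationN {f} : bounded_measurable f ->
  \int[P]_x - f x = - \int[P]_x f x.
Proof.
move=> bf; rewrite -mulN1r -RexpectationZ//.
by apply: eq_Rintegral => x _; rewrite mulN1r.
Qed.

Lemma Rexpectation_indic (A : set T) : measurable A ->
  \int[P]_x \1_A x = fine (P A).
Proof. by move=> mA; rewrite /Rintegral integral_indic// setIT. Qed.

Lemma Rexpectation_sum I (s : seq I) (f : I -> T -> R) :
  (forall i, bounded_measurable (f i)) ->
  \int[P]_x (\sum_(i <- s) f i x) = \sum_(i <- s) \int[P]_x f i x.
Proof.
move=> bf; elim: s => [|i s ih].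
  rewrite big_nil; under eq_Rintegral do rewrite big_nil.
  by rewrite Rintegral_cst// mul0r.
under eq_Rintegral do rewrite big_cons.
by rewrite (RexpectationD (bf i) (bounded_measurable_sum _ s f bf)) big_cons ih.
Qed.

End expectation_bounded.

Lemma bounded_measurable_comp {d} {T : measurableType d} {R : realType}
    {f : R -> R} {X : T -> R} : bounded_measurable f -> measurable_fun setT X ->
  bounded_measurable (fun w => f (X w)).
Proof.
move=> [mf [K fK]] mX; split; first exact: measurableT_comp.
by exists K => x.
Qed.

Lemma bounded_measurable_cos {R : realType} (t : R) :
  bounded_measurable (fun x => cos (t * x)).
Proof.
split; last by exists 1 => x; exact: cos_max.
apply: measurableT_comp; last exact: mulrl_measurable.
by apply: continuous_measurable_fun; exact: continuous_cos.
Qed.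

Lemma bounded_measurable_sin {R : realType} (t : R) :
  bounded_measurable (fun x => sin (t * x)).
Proof.
split; last by exists 1 => x; exact: sin_max.
apply: measurableT_comp; last exact: mulrl_measurable.
by apply: continuous_measurable_fun; exact: continuous_sin.
Qed.

(** * Characteristic functions of independent sums *)

Section independence.
Context {d} {T : measurableType d} {R : realType} (P : probability T R).
Variable Y : nat -> T -> R.
Hypothesis mY : forall n, measurable_fun setT (Y n).
Implicit Types G : T -> R.

Let rect (I : seq nat) (B : nat -> set R) :=
  \big[setI/setT]_(i <- I) (Y i @^-1` B i).

Let measurable_rect I B : (forall i, measurable (B i)) -> measurable (rect I B).
Proof.
move=> mB; rewrite /rect; elim: I => [|i I ih]; first by rewrite big_nil.
rewrite big_cons; apply: measurableI => //.
by rewrite -[X in measurable X]setTI; exact: mY.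
Qed.

(* Unlike independence of sigma-algebras, this is stable under linear
   combinations by mere linearity, which is what the addition formulas for
   [cos] and [sin] require. *)
Definition tail_independent N G := bounded_measurable G /\
  forall I (B : nat -> set R), uniq I -> (forall i, i \in I -> (N <= i)%N) ->
    (forall i, measurable (B i)) ->
  \int[P]_w (G w * \1_(rect I B) w) =
  (\int[P]_w G w) * \prod_(i <- I) fine (P (Y i @^-1` B i)).

Lemma tail_independent_cst (c : R) : mutually_independent P Y ->
  tail_independent 0 (fun=> c).
Proof.
move=> indep; split; first exact: bounded_measurable_cst.
move=> I B uI _ mB.
have b1 := bounded_measurable_indic (R := R) (measurable_rect I B mB).
rewrite (RexpectationZ P c b1).
rewrite Rexpectation_indic; last exact: measurable_rect.
rewrite Rintegral_cst//= probability_setT mulr1 indep//; congr (_ * _).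
rewrite (eq_bigr (fun i => (fine (P (Y i @^-1` B i)))%:E)).
  by rewrite -(big_morph EFin EFinM erefl).
move=> i _; rewrite fineK// fin_num_measure// -[X in measurable X]setTI.
exact: mY.
Qed.

Lemma tail_independentD N G H : tail_independent N G -> tail_independent N H ->
  tail_independent N (fun w => G w + H w).
Proof.
move=> [bG iG] [bH iH]; split; first exact: bounded_measurableD.
move=> I B uI NI mB.
have b1 := bounded_measurable_indic (R := R) (measurable_rect I B mB).
under eq_Rintegral do rewrite mulrDl.
have bGH := (bounded_measurableM bG b1, bounded_measurableM bH b1).
by rewrite (RexpectationD P bGH.1 bGH.2) (RexpectationD P bG bH) iG ?iH ?mulrDl.
Qed.

Lemma tail_independentN N G : tail_independent N G ->
  tail_independent N (fun w => - G w).
Proof.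
move=> [bG iG]; split; first exact: bounded_measurableN.
move=> I B uI NI mB.
have b1 := bounded_measurable_indic (R := R) (measurable_rect I B mB).
under eq_Rintegral do rewrite mulNr.
rewrite (RexpectationN P (bounded_measurableM bG b1)) (RexpectationN P bG).
by rewrite iG ?mulNr.
Qed.

Lemma tail_independent_factor N G (f : R -> R) I (B : nat -> set R) :
  tail_independent N G -> bounded_measurable f -> uniq I ->
  (forall i, i \in I -> (N < i)%N) -> (forall i, measurable (B i)) ->
  \int[P]_w (G w * f (Y N w) * \1_(rect I B) w) =
  (\int[P]_w G w) * (\int[P]_w f (Y N w)) *
  \prod_(i <- I) fine (P (Y i @^-1` B i)).
Proof.
move=> [bG iG] bf uI NI mB.
set c := \prod_(i <- I) _.
have b1 := bounded_measurable_indic (R := R) (measurable_rect I B mB).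
have bY (g : R -> R) : bounded_measurable g ->
    bounded_measurable (fun w => g (Y N w)).
  by move=> bg; exact: (bounded_measurable_comp bg (mY N)).
have bGY (g : R -> R) : bounded_measurable g ->
    bounded_measurable (fun w => G w * g (Y N w) * \1_(rect I B) w).
  by move=> bg; do 2 apply: bounded_measurableM => //; exact: bY.
have [K GK] := bG.2.
apply/eqP; rewrite -subr_eq0; apply/eqP.
pose L (g : R -> R) := \int[P]_w (G w * g (Y N w) * \1_(rect I B) w) -
  (\int[P]_w G w) * (\int[P]_w g (Y N w)) * c.
apply: (@bounded_functional_eq0 _ _ _ L (K + K * `|c|)) => //.
- move=> g h bg bh; rewrite /L.
  under eq_Rintegral do rewrite mulrDr mulrDl.
  rewrite (RexpectationD P (bGY _ bg) (bGY _ bh)).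
  rewrite (RexpectationD P (bY _ bg) (bY _ bh)).
  ring.
- move=> k g bg; rewrite /L.
  under eq_Rintegral do rewrite mulrCA -mulrA.
  rewrite (RexpectationZ P k (bGY _ bg)) (RexpectationZ P k (bY _ bg)).
  ring.
- move=> g e bg ge; rewrite /L.
  have K0 : 0 <= K by exact: le_trans (GK point).
  have e0 : 0 <= e by exact: le_trans (ge point).
  rewrite (le_trans (ler_normB _ _))// mulrDl lerD//.
    apply: Rexpectation_norm_le; first exact: bGY.
    move=> x; rewrite !normrM -[leRHS]mulr1 ler_pM ?ler_pM//.
    by rewrite indicE; case: (_ \in _); rewrite ?normr0 ?normr1.
  rewrite !normrM [leRHS]mulrAC ler_wpM2r// ler_pM//.
    exact: Rexpectation_norm_le.
  by apply: Rexpectation_norm_le => //; exact: bY.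
- move=> C mC; rewrite /L.
  pose B' i := if i == N then C else B i.
  have mB' i : measurable (B' i) by rewrite /B'; case: ifP.
  have B'N : B' N = C by rewrite /B' eqxx.
  have NnI : N \notin I by apply/negP => /NI; rewrite ltnn.
  have eB' : {in I, B' =1 B}.
    by move=> i iI; rewrite /B'; case: eqP => // iN; rewrite -iN iI in NnI.
  have := iG (N :: I) B'; rewrite /= NnI uI => /(_ isT).
  have NI' i : i \in N :: I -> (N <= i)%N.
    by rewrite inE => /predU1P[->//|/NI/ltnW].
  move=> /(_ NI' mB').
  rewrite big_cons B'N (_ : \prod_(i <- I) _ = c); last first.
    by apply: eq_big_seq => i iI; rewrite eB'.
  rewrite (_ : rect (N :: I) B' = (Y N @^-1` C) `&` rect I B); last first.
    rewrite /rect big_cons B'N; congr (_ `&` _).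
    by apply: eq_big_seq => i iI; rewrite eB'.
  rewrite indicI/=; under eq_Rintegral do rewrite mulrA.
  move=> ->; have -> : (fun w => \1_C (Y N w)) = \1_(Y N @^-1` C) :> (T -> R).
    by apply/funext => w; rewrite !indicE; congr (_%:R).
  rewrite Rexpectation_indic ?mulrA ?subrr//.
  by rewrite -[X in measurable X]setTI; exact: mY.
Qed.

Lemma Rexpectation_tail_independentM N G (f : R -> R) :
  tail_independent N G -> bounded_measurable f ->
  \int[P]_w (G w * f (Y N w)) = (\int[P]_w G w) * (\int[P]_w f (Y N w)).
Proof.
move=> iG bf.
have := tail_independent_factor N G f [::] (fun=> setT) iG bf isT.
rewrite /rect !big_nil mulr1 indicT => <-//.
by apply: eq_Rintegral => w _; rewrite /= mulr1.
Qed.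

Lemma tail_independentM N G (f : R -> R) :
  tail_independent N G -> bounded_measurable f ->
  tail_independent N.+1 (fun w => G w * f (Y N w)).
Proof.
move=> iG bf; split.
  apply: bounded_measurableM; first exact: iG.1.
  exact: (bounded_measurable_comp bf (mY N)).
move=> I B uI NI mB; rewrite Rexpectation_tail_independentM//.
exact: tail_independent_factor.
Qed.

Lemma tail_independent_cos_sin (c : nat -> R) t N : mutually_independent P Y ->
  tail_independent N (fun w => cos (t * \sum_(n < N) c n * Y n w)) /\
  tail_independent N (fun w => sin (t * \sum_(n < N) c n * Y n w)).
Proof.
move=> indep; elim: N => [|N [ihc ihs]].
  under eq_fun do rewrite big_ord0 mulr0 cos0.
  under [X in _ /\ tail_independent _ X]eq_fun do rewrite big_ord0 mulr0 sin0.
  by split; exact: tail_independent_cst.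
have bc := bounded_measurable_cos (t * c N).
have bs := bounded_measurable_sin (t * c N).
split.
  under eq_fun do rewrite big_ord_recr/= mulrDr cosD mulrA.
  apply: tail_independentD; first exact: tail_independentM ihc bc.
  by apply: tail_independentN; exact: tail_independentM ihs bs.
under eq_fun do rewrite big_ord_recr/= mulrDr sinD mulrA.
apply: tail_independentD; first exact: tail_independentM ihs bc.
exact: tail_independentM ihc bs.
Qed.

Lemma charfun_abs_sum (c : nat -> R) t N : mutually_independent P Y ->
  charfun_abs P (fun w => \sum_(n < N) c n * Y n w) t =
  \prod_(n < N) charfun_abs P (Y n) (t * c n).
Proof.
move=> indep; elim: N => [|N ih].
  rewrite big_ord0 (_ : (fun w => _) = fun=> 0); last first.
    by apply/funext => w; rewrite big_ord0.
  rewrite /charfun_abs /charfun_re /charfun_im !expectation.unlock mulr0 cos0 sin0.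
  rewrite -!/(Rintegral _ _ _) !Rintegral_cst//= probability_setT.
  by rewrite mul1r mul0r expr0n addr0 expr1n sqrtr1.
rewrite big_ord_recr/= -ih /charfun_abs -sqrtrM ?addr_ge0 ?sqr_ge0//.
congr Num.sqrt; rewrite /charfun_re /charfun_im !expectation.unlock.
rewrite -!/(Rintegral _ _ _).
have [ic is_] := tail_independent_cos_sin c t N indep.
have bc := bounded_measurable_cos (t * c N).
have bs := bounded_measurable_sin (t * c N).
have bcY := bounded_measurable_comp bc (mY N).
have bsY := bounded_measurable_comp bs (mY N).
under eq_Rintegral do rewrite big_ord_recr/= mulrDr cosD mulrA.
under [X in _ + X ^+ 2 = _]eq_Rintegral
  do rewrite big_ord_recr/= mulrDr sinD mulrA.
rewrite (RexpectationD P (bounded_measurableM ic.1 bcY)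
  (bounded_measurableN (bounded_measurableM is_.1 bsY))).
rewrite (RexpectationN P (bounded_measurableM is_.1 bsY)).
rewrite (RexpectationD P (bounded_measurableM is_.1 bcY)
  (bounded_measurableM ic.1 bsY)).
rewrite (Rexpectation_tail_independentM _ _ _ ic bc).
rewrite (Rexpectation_tail_independentM _ _ _ is_ bs).
rewrite (Rexpectation_tail_independentM _ _ _ ic bs).
rewrite (Rexpectation_tail_independentM _ _ _ is_ bc).
ring.
Qed.

Lemma identically_distributed_Rexpectation n (f : R -> R) :
  identically_distributed P Y -> bounded_measurable f ->
  \int[P]_w f (Y n w) = \int[P]_w f (Y 0%N w).
Proof.
move=> id bf; apply/eqP; rewrite -subr_eq0; apply/eqP.
pose L (g : R -> R) := \int[P]_w g (Y n w) - \int[P]_w g (Y 0%N w).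
have bY m (g : R -> R) : bounded_measurable g ->
    bounded_measurable (fun w => g (Y m w)).
  by move=> bg; exact: (bounded_measurable_comp bg (mY m)).
apply: (@bounded_functional_eq0 _ _ _ L 2) => //.
- move=> g h bg bh; rewrite /L.
  rewrite (RexpectationD P (bY n _ bg) (bY n _ bh)).
  rewrite (RexpectationD P (bY 0%N _ bg) (bY 0%N _ bh)).
  ring.
- move=> k g bg; rewrite /L.
  rewrite (RexpectationZ P k (bY n _ bg)) (RexpectationZ P k (bY 0%N _ bg)).
  ring.
- move=> g e bg ge; rewrite mulr_natl mulr2n (le_trans (ler_normB _ _))// lerD//;
  by apply: Rexpectation_norm_le => //; exact: bY.
- move=> C mC; rewrite /L.
  have h m : (fun w => \1_C (Y m w)) = \1_(Y m @^-1` C) :> (T -> R).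
    by apply/funext => w; rewrite !indicE; congr (_%:R).
  rewrite !h !Rexpectation_indic; first by rewrite id// subrr.
    by rewrite -[X in measurable X]setTI; exact: mY.
  by rewrite -[X in measurable X]setTI; exact: mY.
Qed.

Lemma identically_distributed_charfun_abs n t : identically_distributed P Y ->
  charfun_abs P (Y n) t = charfun_abs P (Y 0%N) t.
Proof.
move=> id; rewrite /charfun_abs /charfun_re /charfun_im !expectation.unlock.
congr (Num.sqrt (_ ^+ 2 + _ ^+ 2)); rewrite -!/(Rintegral _ _ _).
- exact: identically_distributed_Rexpectation (bounded_measurable_cos t).
- exact: identically_distributed_Rexpectation (bounded_measurable_sin t).
Qed.

End independence.

(** * The small ball estimate *)

Section trigonometric_kernel.
Context {R : realType}.

Lemma cos1_le_cos (x : R) : `|x| <= 1 -> cos 1 <= cos x.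
Proof.
move=> x1.
have cosx : cos x = cos `|x| by case: (ger0P x) => // _; rewrite cosN.
have pi1 : 1 <= pi :> R by rewrite (le_trans _ (pi_ge2 R))// ler1n.
have ix : `|x| \in `[0, pi] by rewrite in_itv/= normr_ge0 (le_trans x1).
have i1 : (1 : R) \in `[0, pi] by rewrite in_itv/= ler01.
by rewrite cosx leNgt ltr_cos// -leNgt.
Qed.

Lemma sum_cos_sub (x : R) M :
  \sum_(k < M) \sum_(l < M) cos ((k%:R - l%:R) * x) =
  (\sum_(k < M) cos (k%:R * x)) ^+ 2 + (\sum_(k < M) sin (k%:R * x)) ^+ 2.
Proof.
rewrite !expr2 !big_distrl -big_split/=; apply: eq_bigr => k _.
rewrite !big_distrr -big_split/=; apply: eq_bigr => l _.
by rewrite mulrBl cosB.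
Qed.

Lemma sum_cos_sub_ge (x : R) M : (0 < M)%N -> `|x| <= M%:R^-1 ->
  (M%:R * cos 1) ^+ 2 <= \sum_(k < M) \sum_(l < M) cos ((k%:R - l%:R) * x).
Proof.
move=> M0 xM.
have coskx (k : 'I_M) : cos 1 <= cos (k%:R * x).
  apply: cos1_le_cos; rewrite normrM ger0_norm//.
  rewrite (@le_trans _ _ (M%:R * M%:R^-1))//.
    by rewrite ler_pM// ler_nat ltnW.
  by rewrite divff// pnatr_eq0 -lt0n.
have sum_ge : M%:R * cos 1 <= \sum_(k < M) cos (k%:R * x).
  rewrite -[in leLHS](card_ord M) -sum1_card natr_sum mulr_suml.
  by apply: ler_sum => k _; rewrite mul1r.
have Mcos : 0 <= M%:R * cos 1 :> R by rewrite mulr_ge0// ltW// cos1_gt0.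
rewrite sum_cos_sub -[leLHS]addr0 lerD ?sqr_ge0//.
by rewrite lerXn2r ?nnegrE// (le_trans Mcos).
Qed.

Lemma double_sum_distance_le (F : nat -> nat -> R) (psi : nat -> R) M :
  (forall m, 0 <= psi m) ->
  (forall k l, (k <= l)%N -> F k l <= psi (l - k)%N /\ F l k <= psi (l - k)%N) ->
  \sum_(k < M) \sum_(l < M) F k l <= 2 * M%:R * \sum_(m < M) psi m.
Proof.
move=> psi0 Fpsi; elim: M => [|M ih]; first by rewrite !big_ord0 mulr0.
rewrite big_ord_recr/=.
under eq_bigr do rewrite big_ord_recr/=.
rewrite big_split/= [\sum_(i < M.+1) F M i]big_ord_recr/=.
have side : \sum_(l < M) psi (M - l)%N = \sum_(l < M) psi l.+1.
  rewrite (reindex_inj rev_ord_inj)/=; apply: eq_bigr => l _.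
  by rewrite subnA// ?subnn// ltnW.
have h1 : \sum_(i < M) F i M <= \sum_(l < M) psi l.+1.
  rewrite -side; apply: ler_sum => i _.
  by have [] := Fpsi i M (ltnW (ltn_ord i)).
have h2 : \sum_(i < M) F M i <= \sum_(l < M) psi l.+1.
  rewrite -side; apply: ler_sum => i _.
  by have [] := Fpsi i M (ltnW (ltn_ord i)).
have h3 : F M M <= psi 0%N by have [] := Fpsi M M (leqnn M); rewrite subnn.
have h4 : psi 0%N + \sum_(l < M) psi l.+1 = \sum_(m < M.+1) psi m.
  by rewrite big_ord_recl.
have h5 : 2 * M%:R * \sum_(m < M) psi m <= 2 * M%:R * \sum_(m < M.+1) psi m.
  by rewrite ler_wpM2l ?mulr_ge0// big_ord_recr/= lerDl.
have := psi0 0%N; rewrite -(natr1 M) mulrDr mulr1 mulrDl.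
by move: ih h1 h2 h3 h4 h5; lra.
Qed.

End trigonometric_kernel.

Section small_ball.
Context {d} {T : measurableType d} {R : realType} (P : probability T R).
Variable S : T -> R.
Hypothesis mS : measurable_fun setT S.

Lemma charfun_absN t : charfun_abs P S (- t) = charfun_abs P S t.
Proof.
rewrite /charfun_abs; congr (Num.sqrt (_ + _)).
  by rewrite /charfun_re; under eq_fun do rewrite mulNr cosN.
rewrite /charfun_im !expectation.unlock -!/(Rintegral _ _ _).
under eq_Rintegral do rewrite mulNr sinN.
rewrite (RexpectationN P (bounded_measurable_comp (bounded_measurable_sin t) mS)).
by rewrite sqrrN.
Qed.

Lemma charfun_re_le t : charfun_re P S t <= charfun_abs P S t.
Proof.
rewrite (le_trans (ler_norm _))// -sqrtr_sqr /charfun_abs ler_wsqrtr//.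
by rewrite lerDl sqr_ge0.
Qed.

Lemma measurable_small_ball (e : R) : measurable [set w | `|S w| <= e].
Proof.
rewrite -[X in measurable X]setTI.
apply: (measurable_fun_le measurableT _ (measurable_cst e)).
exact: measurableT_comp.
Qed.

Lemma small_ball_charfun_le M : (0 < M)%N ->
  cos 1 ^+ 2 * M%:R * fine (P [set w | `|S w| <= M%:R^-1]) <=
  2 * \sum_(m < M) charfun_abs P S m%:R.
Proof.
move=> M0; set A := [set w | _].
have mA : measurable A := measurable_small_ball _.
have bA := bounded_measurable_indic (R := R) mA.
have bcS t : bounded_measurable (fun w => cos (t * S w)).
  exact: (bounded_measurable_comp (bounded_measurable_cos t) mS).
rewrite -(@ler_pM2l _ M%:R) ?ltr0n//.
rewrite [leLHS](_ : _ = (M%:R * cos 1) ^+ 2 * fine (P A)); last by ring.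
rewrite -Rexpectation_indic// -(RexpectationZ P _ bA).
pose F k l : R := charfun_re P S (k%:R - l%:R).
apply: (@le_trans _ _ (\sum_(k < M) \sum_(l < M) F k l)).
  have -> : \sum_(k < M) \sum_(l < M) F k l =
      \int[P]_w (\sum_(k < M) \sum_(l < M) cos ((k%:R - l%:R) * S w)).
    rewrite Rexpectation_sum; last first.
      by move=> k; apply: bounded_measurable_sum => l; exact: bcS.
    apply: eq_bigr => k _; rewrite Rexpectation_sum; last by move=> l; exact: bcS.
    by apply: eq_bigr => l _; rewrite /F /charfun_re expectation.unlock.
  apply: le_Rintegral => //.
  - by apply: bounded_measurable_integrable; exact: bounded_measurableZ.
  - apply: bounded_measurable_integrable.
    by do 2 apply: bounded_measurable_sum => ?; exact: bcS.
  - move=> w _; rewrite indicE; have [|_] := boolP (w \in A).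
      by rewrite inE /A/= => wA; rewrite mulr1; exact: sum_cos_sub_ge.
    by rewrite mulr0 sum_cos_sub addr_ge0 ?sqr_ge0.
apply: (@le_trans _ _ (2 * M%:R * \sum_(m < M) charfun_abs P S m%:R)).
  apply: (double_sum_distance_le F (fun m => charfun_abs P S m%:R)).
    by move=> m; exact: sqrtr_ge0.
  move=> k l kl; rewrite /F natrB//; split; last exact: charfun_re_le.
  by rewrite -charfun_absN opprB; exact: charfun_re_le.
by rewrite mulrA [M%:R * 2]mulrC.
Qed.

End small_ball.

Section decay.
Context {R : realType}.

Lemma sum_geometric_le (q : R) n : 0 <= q < 1 ->
  \sum_(j < n) q ^+ j <= (1 - q)^-1.
Proof.
move=> /andP[q0 q1]; rewrite -[leRHS]mul1r ler_pdivlMr ?subr_gt0// mulrC.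
rewrite -opprB mulNr -subrX1 opprB lerBlDr lerDl exprn_ge0//.
Qed.

Lemma sum_nat_lt_le (x : R) M : 0 <= x ->
  \sum_(m < M) (m%:R < x)%R%:R <= x + 1.
Proof.
move=> x0; elim: M => [|M ih]; first by rewrite big_ord0 addr_ge0.
rewrite big_ord_recr/=; have [Mx|_] := ltP M%:R x; last by rewrite addr0.
rewrite lerD// (le_trans _ (ltW Mx))//.
rewrite -[in leRHS](card_ord M) -sum1_card natr_sum; apply: ler_sum => m _.
by case: (_ < _).
Qed.

Lemma prod_le_geometric (f : R -> R) (delta r t0 : R) (m : R) N :
  0 <= delta -> 0 <= m ->
  (forall t, 0 <= t -> 0 <= f t <= 1) ->
  (forall t, t0 <= t -> f t <= delta) ->
  0 < r < 1 -> m * r ^+ N.+1 < t0 ->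
  \prod_(n < N) f (m * r ^+ n.+1) <=
  \sum_(j < N.+1) delta ^+ j * (m * r ^+ j.+1 < t0)%R%:R.
Proof.
move=> d0 m0 f01 fd /andP[r0 r1] mN.
have ex : exists j, m * r ^+ j.+1 < t0 by exists N.
(* [j] is the number of [n >= 1] with [m * r ^ n >= t0]. *)
case: (ex_minnP ex) => j jt jmin.
have jN : (j <= N)%N := jmin N mN.
rewrite (bigD1 (inord j))//= inordK// jt mulr1 -[leLHS]addr0 lerD//; last first.
  by apply: sumr_ge0 => i _; rewrite mulr_ge0 ?exprn_ge0.
have f01' i : 0 <= f (m * r ^+ i) <= 1.
  by apply: f01; rewrite mulr_ge0// exprn_ge0// ltW.
have f0 i : 0 <= f (m * r ^+ i) by case/andP: (f01' i).
rewrite -(big_mkord xpredT (fun n => f (m * r ^+ n.+1))) (@big_cat_nat _ _ _ j)//=.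
rewrite -[leRHS]mulr1 ler_pM ?prodr_ge0//.
  rewrite big_mkord -[leRHS]mulr1 -[j in leRHS]card_ord -prodr_const mulr1.
  apply: ler_prod => i _; rewrite f0 fd// leNgt; apply/negP => /jmin.
  by rewrite leqNgt ltn_ord.
rewrite [leRHS](_ : 1 = \prod_(j <= n < N) 1); last by rewrite big1.
exact: ler_prod.
Qed.

Lemma sum_prod_le (f : R -> R) (delta r t0 : R) M N :
  (forall t, 0 <= t -> 0 <= f t <= 1) ->
  (forall t, t0 <= t -> f t <= delta) ->
  0 < delta < r -> r < 1 -> 0 < t0 -> M%:R * r ^+ N.+1 < t0 ->
  \sum_(m < M) \prod_(n < N) f (m%:R * r ^+ n.+1) <=
  t0 / r / (1 - delta / r) + (1 - delta)^-1.
Proof.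
move=> f01 fd /andP[d0 dr] r1 t00 MN.
have r0 : 0 < r := lt_trans d0 dr.
apply: (@le_trans _ _ (\sum_(m < M) \sum_(j < N.+1)
    delta ^+ j * (m%:R * r ^+ j.+1 < t0)%R%:R)).
  apply: ler_sum => m _; apply: prod_le_geometric => //; rewrite ?ltW ?r0//.
  by rewrite (le_lt_trans _ MN)// ler_wpM2r ?exprn_ge0 ?(ltW r0)// ler_nat ltnW.
rewrite exchange_big/=.
apply: (@le_trans _ _ (\sum_(j < N.+1) (t0 / r * (delta / r) ^+ j + delta ^+ j))).
  apply: ler_sum => j _; rewrite -mulr_sumr.
  under eq_bigr do rewrite -ltr_pdivlMr ?exprn_gt0//.
  apply: (@le_trans _ _ (delta ^+ j * (t0 / r ^+ j.+1 + 1))).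
    rewrite ler_wpM2l ?exprn_ge0 ?(ltW d0)// sum_nat_lt_le//.
    by rewrite divr_ge0 ?exprn_ge0 ?ltW.
  rewrite mulrDr mulr1 lerD2r expr_div_n exprS.
  have rj : r ^+ j != 0 by rewrite expf_neq0 ?gt_eqF.
  by rewrite le_eqVlt; apply/orP; left; apply/eqP; field; rewrite rj gt_eqF.
rewrite big_split/= lerD//.
  rewrite -mulr_sumr ler_wpM2l ?divr_ge0 ?(ltW r0) ?(ltW t00)// sum_geometric_le//.
  by rewrite divr_ge0 ?(ltW d0) ?(ltW r0)//= ltr_pdivrMr// mul1r.
by rewrite sum_geometric_le// ltW//= (lt_trans dr).
Qed.

End decay.

(** * Passage to the limit *)

Section measurable_limit.
Context {d} {T : measurableType d} {R : realType}.

Lemma cvgn_cauchyP (u : R^nat) : cvgn u <->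
  forall k, exists N, forall n, (N <= n)%N -> `|u N - u n| <= k.+1%:R^-1.
Proof.
split=> [/cvg_ex[l ul] k|cu].
  have e0 : 0 < k.+1%:R^-1 / 2 :> R by rewrite divr_gt0.
  have [N _ Nl] := (@cvgrPdist_le _ _ _ _ _ _ _).1 ul _ e0.
  exists N => n Nn; rewrite -[u N](subrK l) -addrA (le_trans (ler_normD _ _))//.
  by rewrite [leRHS]splitr lerD// ?Nl// distrC; exact: Nl (leqnn N).
apply: cauchy_cvg; apply: cauchy_exP => e e0.
pose k := Num.truncn e^-1.
have [N Nu] := cu k; exists (u N); exists N => // n /= Nn.
rewrite /ball/= (le_lt_trans (Nu _ Nn))// invf_plt ?posrE//.
exact: truncnS_gt.
Qed.

Variable S : nat -> T -> R.
Hypothesis mS : forall n, measurable_fun setT (S n).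

Lemma measurable_cvgn : measurable [set w | cvgn (S^~ w)].
Proof.
rewrite (_ : [set w | _] = \bigcap_k \bigcup_N \bigcap_(n in [set n | (N <= n)%N])
    [set w | `|S N w - S n w| <= k.+1%:R^-1]); last first.
  apply/seteqP; split => w /=.
    by move=> /cvgn_cauchyP cw k _; have [N Nw] := cw k; exists N.
  by move=> cw; apply/cvgn_cauchyP => k; have [N _ Nw] := cw k I; exists N.
apply: bigcap_measurable => // k _; apply: bigcup_measurable => N _.
apply: bigcap_measurable; first by exists N => /=.
move=> n _; apply: measurable_small_ball.
exact: measurable_funB.
Qed.

Lemma measurable_limn : measurable_fun setT (fun w => limn (S^~ w)).
Proof.
have mC := measurable_cvgn; set C := [set w | _] in mC.
rewrite -(setUv C); apply/measurable_funU => //; first exact: measurableC.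
split.
  apply: (@measurable_fun_cvg _ _ _ _ S).
    by move=> m; apply: measurable_funTS.
  by move=> w Cw.
apply: (@eq_measurable_fun _ _ _ _ _ (fun=> point)).
  by move=> w; rewrite inE => Cw; rewrite dvgP.
exact: measurable_cst.
Qed.

End measurable_limit.

Section limit_small_ball.
Context {d} {T : measurableType d} {R : realType} (P : probability T R).
Variable S : nat -> T -> R.
Hypothesis mS : forall n, measurable_fun setT (S n).

Lemma limn_small_ball_le (e e' : R) (c : \bar R) : e < e' ->
  P [set w | ~ cvgn (S^~ w)] = 0%E ->
  (\forall n \near \oo, (P [set w | (`|S n w| <= e')%R] <= c)%E) ->
  (P [set w | (`|limn (S^~ w)| <= e)%R] <= c)%E.
Proof.
move=> ee' PC [N0 _ Pc].
pose A N := \bigcap_(n in [set n | (N <= n)%N]) [set w | `|S n w| <= e'].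
have mA N : measurable (A N).
  apply: bigcap_measurable; first by exists N => /=.
  by move=> n _; exact: measurable_small_ball.
have mUA : measurable (\bigcup_N A N) by exact: bigcup_measurable.
have mC : measurable [set w | ~ cvgn (S^~ w)].
  rewrite (_ : [set w | _] = ~` [set w | cvgn (S^~ w)])//.
  by apply: measurableC; exact: measurable_cvgn.
have PA : (P (\bigcup_N A N) <= c)%E.
  have ndA : nondecreasing_seq A.
    move=> m n mn; apply/subsetPset => w Aw k /= nk; apply: Aw => /=.
    exact: leq_trans nk.
  have cA := nondecreasing_cvg_mu (mu := P) mA mUA ndA.
  rewrite -(cvg_lim _ cA)//; apply: lime_le.
    by apply/cvg_ex; eexists; exact: cA.
  apply: nearW => n /=; apply: le_trans (Pc (maxn n N0) _); last exact: leq_maxr.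
  apply: le_measure; rewrite ?inE//; first exact: measurable_small_ball.
  by move=> w; apply => /=; exact: leq_maxl.
apply: le_trans PA; rewrite -[leRHS]adde0 -[X in (_ <= _ + X)%E]PC.
apply: (le_trans _ (measureU2 _ _ _)) => //.
apply: le_measure; rewrite ?inE//.
- by apply: measurable_small_ball; exact: measurable_limn.
- exact: measurableU.
move=> w /= Zw; have [cw|] := pselect (cvgn (S^~ w)); last by right.
left; have e0 : 0 < e' - e by rewrite subr_gt0.
have [N _ NS] := (@cvgrPdist_le _ _ _ _ _ _ _).1 cw _ e0.
exists N => // n /= Nn; rewrite -[S n w](subrK (limn (S^~ w))).
rewrite (le_trans (ler_normD _ _))// -[leRHS](subrK e) lerD// distrC.
exact: NS.
Qed.

End limit_small_ball.

Section charfun_bound.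
Context {d} {T : measurableType d} {R : realType} (P : probability T R).

Lemma charfun_abs_norm (X : T -> R) t : measurable_fun setT X ->
  charfun_abs P X `|t| = charfun_abs P X t.
Proof. by move=> mX; case: (ger0P t) => // _; rewrite charfun_absN. Qed.

(* With [phi = u + iv], [|phi|^2 = E(u cos tX + v sin tX) <= |phi|]. *)
Lemma charfun_abs_le1 (X : T -> R) t : measurable_fun setT X ->
  charfun_abs P X t <= 1.
Proof.
move=> mX; set s := charfun_abs P X t.
pose u := charfun_re P X t; pose v := charfun_im P X t.
have s0 : 0 <= s by exact: sqrtr_ge0.
have s2 : s ^+ 2 = u ^+ 2 + v ^+ 2 by rewrite sqr_sqrtr ?addr_ge0 ?sqr_ge0.
have bc := bounded_measurable_comp (bounded_measurable_cos t) mX.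
have bs := bounded_measurable_comp (bounded_measurable_sin t) mX.
have : `|\int[P]_w (u * cos (t * X w) + v * sin (t * X w))| <= s.
  apply: Rexpectation_norm_le.
    by apply: bounded_measurableD; exact: bounded_measurableZ.
  move=> w; rewrite -sqrtr_sqr /s /charfun_abs ler_wsqrtr// -/u -/v.
  have := cos2Dsin2 (t * X w); set c := cos _; set z := sin _ => cz.
  rewrite -[leRHS]mulr1 -cz -subr_ge0.
  rewrite [leRHS](_ : _ = (u * z - v * c) ^+ 2) ?sqr_ge0//; ring.
rewrite (RexpectationD P (bounded_measurableZ u bc) (bounded_measurableZ v bs)).
rewrite (RexpectationZ P u bc) (RexpectationZ P v bs).
have -> : \int[P]_w cos (t * X w) = u.
  by rewrite /u /charfun_re expectation.unlock.
have -> : \int[P]_w sin (t * X w) = v.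
  by rewrite /v /charfun_im expectation.unlock.
rewrite -!expr2 -s2 ger0_norm ?sqr_ge0// => ss; rewrite leNgt; apply/negP => s1.
have := ltr_pM2l (lt_trans ltr01 s1) 1 s.
by rewrite s1 mulr1 -expr2 ltNge ss.
Qed.

End charfun_bound.

Section random_series.
Context {d} {T : measurableType d} {R : realType} (P : probability T R).
Variable Y : nat -> {RV P >-> R}.
Hypothesis idY : identically_distributed P (fun n => Y n).

Lemma tail_probability_le (a x : R) n : 0 < a -> 0 < x ->
  ('E_P[(fun w => `|Y 0%N w| `^ a)%R] < +oo)%E ->
  (P [set w | (x <= `|Y n w|)%R] <=
   (fine 'E_P[(fun w => `|Y 0%N w| `^ a)%R] / x `^ a)%:E)%E.
Proof.
move=> a0 x0 Eoo.
have mB : measurable [set y : R | x <= `|y|].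
  rewrite -[X in measurable X]setTI.
  exact: (measurable_fun_le measurableT (measurable_cst x) (@normr_measurable _ _)).
have := idY n _ mB; rewrite /preimage/= => ->.
have xa : 0 < x `^ a by exact: powR_gt0.
have E0 : (0 <= 'E_P[(fun w => `|Y 0%N w| `^ a)%R])%E.
  by apply: expectation_ge0 => w; exact: powR_ge0.
have := @markov _ _ _ P (Y 0%N) (@powR R ^~ a) x x0 (measurable_powR a).
move=> /(_ (fun r _ => powR_ge0 _ _)) /(_ _)/wrap[].
  by move=> y z y0 z0 yz; apply: ge0_ler_powR => //; exact: ltW.
rewrite (_ : [set _ | _] = [set w | x <= `|Y 0%N w|]); last first.
  by apply/seteqP; split => w /=; rewrite lee_fin.
have PA : P [set w | x <= `|Y 0%N w|] \is a fin_num.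
  by rewrite fin_num_measure//; exact: (measurable_funPTI (Y 0%N) mB).
have Efin : ('E_P[(fun w => `|Y 0%N w| `^ a)%R] \is a fin_num)%E.
  by rewrite ge0_fin_numE.
rewrite /comp -(fineK PA) -[X in (_ <= X)%E -> _](fineK Efin) -EFinM !lee_fin.
by rewrite ler_pdivlMr// mulrC.
Qed.

Lemma series_cvg_ae (rho a : R) : -1 < rho < 1 -> rho != 0 -> 0 < a ->
  ('E_P[(fun w => `|Y 0%N w| `^ a)%R] < +oo)%E ->
  P [set w | ~ cvgn (fun N => \sum_(n < N) rho ^+ n.+1 * Y n w)] = 0%E.
Proof.
move=> /andP[rho1 rho2] rho0 a0 Eoo.
have r1 : `|rho| < 1 by rewrite ltr_norml rho1.
pose r := (1 + `|rho|) / 2.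
have rn0 : 0 < `|rho| by rewrite normr_gt0.
have rr : `|rho| < r by rewrite /r; lra.
have rlt1 : r < 1 by rewrite /r; lra.
have r0 : 0 < r := lt_trans rn0 rr.
pose F n := [set w | r ^- n <= `|Y n w|].
have mF n : measurable (F n).
  rewrite -[X in measurable X]setTI.
  apply: (measurable_fun_le measurableT (measurable_cst _)).
  exact: measurableT_comp.
pose E := fine 'E_P[(fun w => `|Y 0%N w| `^ a)%R].
have E0 : 0 <= E.
  by apply: fine_ge0; apply: expectation_ge0 => w; exact: powR_ge0.
pose q := r `^ a.
have q0 : 0 < q by exact: powR_gt0.
have q1 : q < 1.
  rewrite -[ltRHS](_ : 1 `^ a = 1); last by rewrite powR1.
  by apply: gt0_ltr_powR; rewrite // nnegrE ltW.
have PF n : (P (F n) <= (E * q ^+ n)%:E)%E.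
  have rn : 0 < r ^- n by rewrite invr_gt0 exprn_gt0.
  apply: le_trans (tail_probability_le a (r ^- n) n a0 rn Eoo) _.
  rewrite lee_fin ler_wpM2l// -powR_invn ?(ltW r0)// -powRrM -powRN mulNr opprK.
  by rewrite -[q ^+ n]powR_mulrn ?(ltW q0)// -powRrM mulrC.
have limF : P (lim_sup_set F) = 0%E.
  apply: lim_sup_set_cvg0 => //.
  apply: (@le_lt_trans _ _ (E / (1 - q))%:E); last exact: ltry.
  apply: lime_le; first exact: is_cvg_nneseries.
  apply: nearW => n; rewrite big_mkord.
  apply: (@le_trans _ _ (\sum_(i < n) (E * q ^+ i)%:E)%E).
    by apply: lee_sum => i _; exact: PF.
  rewrite sumEFin lee_fin -mulr_sumr ler_wpM2l// sum_geometric_le//.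
  by rewrite (ltW q0).
apply/eqP; rewrite eq_le measure_ge0 andbT -limF; apply/le_measure.
- pose S N w := \sum_(n < N) rho ^+ n.+1 * Y n w.
  rewrite inE (_ : [set w | _] = ~` [set w | cvgn (S^~ w)])//.
  apply: measurableC; apply: measurable_cvgn.
  by move=> N; apply: measurable_sum => n; exact: measurable_funM.
- rewrite inE; apply: bigcap_measurable => // n _; exact: bigcup_measurable.
move=> w /= ncw n _; apply: contrapT => nF; apply: ncw.
have Yle k : (n <= k)%N -> `|Y k w| <= r ^- k.
  move=> nk; rewrite leNgt; apply/negP => rY; apply: nF.
  by exists k => //=; exact: ltW.
rewrite (_ : (fun N => _) = series (fun k => rho ^+ k.+1 * Y k w)); last first.
  by apply/funext => N; rewrite /series/= big_mkord.
pose D := 1 + \sum_(k < n) `|Y k w| * r ^+ k.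
have s0 m : 0 <= \sum_(k < m) `|Y k w| * r ^+ k.
  by apply: sumr_ge0 => k _; rewrite mulr_ge0// exprn_ge0// ltW.
have YD k : `|Y k w| <= D * r ^- k.
  have [nk|kn] := leqP n k.
    by rewrite (le_trans (Yle _ nk))// ler_peMl ?invr_ge0 ?exprn_ge0 ?(ltW r0)//
      lerDl.
  rewrite ler_pdivlMr ?exprn_gt0// /D (bigD1 (Ordinal kn))//= addrCA.
  rewrite lerDl addr_ge0//.
  by apply: sumr_ge0 => i _; rewrite mulr_ge0// exprn_ge0// ltW.
apply: normed_cvg; apply: (@series_le_cvg _ _ (geometric D (`|rho| / r))) => //.
- by move=> k /=.
- move=> k /=; rewrite mulr_ge0 ?exprn_ge0 ?divr_ge0 ?(ltW r0)//.
  by rewrite addr_ge0.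
- move=> k /=; rewrite normrM normrX exprS expr_div_n.
  rewrite (@le_trans _ _ (`|rho| ^+ k * (D * r ^- k)))//.
    rewrite ler_pM ?mulr_ge0 ?exprn_ge0// ler_piMl ?exprn_ge0// ltW//.
  by rewrite mulrCA.
- apply: is_cvg_geometric_series.
  by rewrite ger0_norm ?divr_ge0 ?(ltW r0)// ltr_pdivrMr// mul1r.
Qed.

Lemma small_ball_partial_sum (rho : R) : -1 < rho < 1 -> rho != 0 ->
  mutually_independent P (fun n => Y n) ->
  (exists delta t0 : R, 0 < delta < `|rho| /\ 0 < t0 /\
     forall t : R, t0 <= `|t| -> charfun_abs P (Y 0%N) t <= delta) ->
  exists C : R, 0 <= C /\ forall M, (0 < M)%N -> \forall N \near \oo,
    (P [set w | (`|\sum_(n < N) rho ^+ n.+1 * Y n w| <= M%:R^-1)%R] <=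
     (C / M%:R)%:E)%E.
Proof.
move=> /andP[rho1 rho2] rho0 indep [delta [t0 [/andP[d0 dr] [t00 phid]]]].
have r1 : `|rho| < 1 by rewrite ltr_norml rho1.
have r0 : 0 < `|rho| by rewrite normr_gt0.
have mY n : measurable_fun setT (Y n) by exact: measurable_funPT.
have mS N : measurable_fun setT (fun w => \sum_(n < N) rho ^+ n.+1 * Y n w).
  by apply: measurable_sum => n; exact: measurable_funM.
pose K := t0 / `|rho| / (1 - delta / `|rho|) + (1 - delta)^-1.
have K0 : 0 <= K.
  rewrite addr_ge0// ?invr_ge0 ?subr_ge0 ?(ltW (lt_trans dr r1))//.
  rewrite !divr_ge0 ?(ltW t00)// subr_ge0 ler_pdivrMr// mul1r ltW//.
have c0 : 0 < cos 1 ^+ 2 :> R by rewrite exprn_gt0// cos1_gt0.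
exists (2 * K / cos 1 ^+ 2); split.
  by apply: divr_ge0; [exact: mulr_ge0|exact: ltW].
move=> M M0.
have : (fun N => M%:R * `|rho| ^+ N) @ \oo --> (0 : R).
  by apply: cvg_geometric; rewrite normr_id.
move=> /cvgrPdist_lt /(_ _ t00)[N0 _ N0t].
exists N0 => // N /= N0N.
have MN : M%:R * `|rho| ^+ N.+1 < t0.
  have := N0t N.+1 (leqW N0N); rewrite sub0r normrN; apply: le_lt_trans.
  exact: ler_norm.
have sumle : \sum_(m < M) charfun_abs P
    (fun w => \sum_(n < N) rho ^+ n.+1 * Y n w) m%:R <= K.
  pose f t := charfun_abs P (Y 0%N) t.
  rewrite (eq_bigr (fun m : 'I_M => \prod_(n < N) f (m%:R * `|rho| ^+ n.+1))).
    apply: sum_prod_le => //; last by rewrite d0.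
    - by move=> t _; rewrite sqrtr_ge0/= charfun_abs_le1.
    - by move=> t t0t; apply: phid; rewrite (le_trans t0t)// ler_norm.
  move=> m _; rewrite (charfun_abs_sum P (fun n => Y n) mY (fun n => rho ^+ n.+1))//.
  apply: eq_bigr => n _.
  rewrite (identically_distributed_charfun_abs P (fun n => Y n) mY)//.
  by rewrite /f -normrX -[m%:R in RHS]ger0_norm// -normrM charfun_abs_norm.
have := small_ball_charfun_le P _ (mS N) M M0.
set A := [set w | _] => PA.
rewrite -(@fineK _ (P A)); last first.
  by rewrite fin_num_measure//; apply: measurable_small_ball.
rewrite lee_fin ler_pdivlMr ?ltr0n// ler_pdivlMr//.
rewrite -mulrA mulrC [M%:R * _]mulrC (le_trans PA)// ler_wpM2l//.
Qed.

End random_series.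

Theorem mainTheorem7 (d : measure_display) (T : measurableType d) (R : realType)
  (P : probability T R) (Y : nat -> {RV P >-> R}) (rho a : R) :
  -1 < rho < 1 -> rho != 0 -> 0 < a ->
  mutually_independent P (fun n => Y n) ->
  identically_distributed P (fun n => Y n) ->
  ('E_P[(fun w => `|Y 0%N w| `^ a)%R] < +oo)%E ->
  (exists delta t0 : R, 0 < delta < `|rho| /\ 0 < t0 /\
     forall t : R, t0 <= `|t| -> charfun_abs P (Y 0%N) t <= delta) ->
  exists C : R, \forall eps \near (0 : R)^'+,
    (P [set w | (`|Zseries rho (fun n => Y n) w| <= eps)%R] <= (C * eps)%:E)%E.
Proof.
move=> rho1 rho0 a0 indep idY Eoo phid.
have [C [C0 CM]] := small_ball_partial_sum P Y idY rho rho1 rho0 indep phid.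
exists (4 * C); near=> eps.
have e0 : 0 < eps by near: eps; exact: nbhs_right_gt.
have e4 : eps < 4^-1 by near: eps; apply: nbhs_right_lt; rewrite invr_gt0.
pose x := (2 * eps)^-1.
have x2 : 2 < x.
  by rewrite /x -[ltLHS]invrK ltf_pV2 ?posrE ?invr_gt0 ?mulr_gt0//; lra.
pose M := Num.truncn x.
have /andP[Mx xM] : M%:R <= x < M.+1%:R by apply: truncn_itv; lra.
have M1 : 1 < M%:R :> R by move: xM; rewrite -natr1; lra.
have M0 : (0 < M)%N by rewrite -(ltr0n R); lra.
have Me : 2 * eps <= M%:R^-1.
  by rewrite -[leLHS]invrK lef_pV2 ?posrE ?invr_gt0 ?mulr_gt0// ltr0n.
have SZ w : Zseries rho (fun n => Y n) w =
    limn (fun N => \sum_(n < N) rho ^+ n.+1 * Y n w).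
  rewrite /Zseries; congr (limn _); apply/funext => N.
  by rewrite /series/= big_mkord.
under eq_set do rewrite SZ.
apply: (@le_trans _ _ (C / M%:R)%:E).
  apply: (limn_small_ball_le P (fun N w => \sum_(n < N) rho ^+ n.+1 * Y n w) _
    _ M%:R^-1).
  - move=> N; apply: measurable_sum => n; apply: measurable_funM => //.
  - lra.
  - exact: (series_cvg_ae P Y idY rho a).
  - exact: CM.
rewrite lee_fin ler_pdivrMr ?ltr0n// [4 * C]mulrC -!mulrA ler_peMr//.
have xe : x * (2 * eps) = 1 by rewrite /x mulVf// gt_eqF// mulr_gt0.
have : x <= 2 * M%:R by move: xM M1; rewrite -natr1; lra.
move=> /(ler_wpM2r (ltW (mulr_gt0 (ltr0n R 2) e0))); rewrite xe; lra.
Unshelve. all: by end_near. Qed.
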